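(* Let $S\subseteq\{0,1\}^n$ be a cube-ideal set-system with connectivity $\lambda$, where $\lambda\geq3$. Then $S$ has VC dimension at least $f(\lambda)\cdot n$, where $f(\lambda)=H^{-1}(1-H(1/\lambda))$.
   Context: A set-system is a subset $S\subseteq\{0,1\}^n$. A GSC inequality is $\sum_{i\in I}x_i+\sum_{j\in J}(1-x_j)\geq1$ for disjoint $I,J\subseteq[n]$, using $|I|+|J|$ variables; capacity inequalities are $x_i\geq0$, $x_i\leq1$. $S$ is cube-ideal if its convex hull $\mathrm{conv}(S)$ is the solution set of a finite family of capacity and GSC inequalities. The connectivity of $S$ is the minimum number of variables in a GSC inequality valid for $\mathrm{conv}(S)$ ($+\infty$ if $S=\{0,1\}^n$). For $I\subseteq[n]$, the projection of $S$ onto $I$ is $\{p_I:p\in S\}$ where $p_I$ is the restriction of $p$ to $I$. The VC dimension of $S$ is the largest $d$ such that some projection of $S$ onto an index set $I$ with $|I|=d$ equals $\{0,1\}^I$ ($0$ if $S=\emptyset$). $H:[0,\tfrac12]\to[0,1]$ is the binary entropy function $H(\varepsilon)=-\varepsilon\log_2\varepsilon-(1-\varepsilon)\log_2(1-\varepsilon)$, $H(0)=0$, and $H^{-1}:[0,1]\to[0,\tfrac12]$ is its inverse. *)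

(* Defs.v *)
From mathcomp Require Import all_boot all_order all_algebra.
From mathcomp Require Import all_classical all_reals all_analysis.

Set Implicit Arguments.
Unset Strict Implicit.
Unset Printing Implicit Defensive.

Import Order.TTheory GRing.Theory Num.Theory.

Local Open Scope classical_set_scope.
Local Open Scope ring_scope.

Definition cube_point (n : nat) := {ffun 'I_n -> bool}.

Definition cube_system (n : nat) := {set cube_point n}.

Section CubeIdeal.
Variables (R : realType) (n : nat).
Implicit Types (S : cube_system n) (I J : {set 'I_n}) (x : 'rV[R]_n).

Definition vec_of_point (p : cube_point n) : 'rV[R]_n := \row_i (p i)%:R.

Definition conv_hull S : set 'rV[R]_n :=
  [set x | exists w : cube_point n -> R,
     [/\ forall p, p \in S -> 0 <= w p,
         \sum_(p in S) w p = 1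
       & x = \sum_(p in S) w p *: vec_of_point p] ].

Definition gsc_ineq I J x : Prop :=
  1 <= \sum_(i in I) x ord0 i + \sum_(j in J) (1 - x ord0 j).

(* The finite family of inequalities is given by its lower capacity part L,
   its upper capacity part U and its GSC part G. *)
Definition cube_ideal S : Prop :=
  exists (L U : {set 'I_n}) (G : {set {set 'I_n} * {set 'I_n}}),
    (forall IJ, IJ \in G -> [disjoint IJ.1 & IJ.2]%B) /\
    conv_hull S = [set x : 'rV[R]_n | [/\ forall i, i \in L -> 0 <= x ord0 i,
                          forall i, i \in U -> x ord0 i <= 1
                        & forall IJ, IJ \in G -> gsc_ineq IJ.1 IJ.2 x] ].

Definition gsc_valid S I J : Prop := conv_hull S `<=` [set x | gsc_ineq I J x].

(* The default value +oo is taken exactly when no GSC inequality is valid,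
   i.e. when S is the whole cube; see connectivity_eqy. *)
Definition connectivity S : \bar R :=
  \big[Order.min/+oo%E]_(IJ : {set 'I_n} * {set 'I_n}
      | [disjoint IJ.1 & IJ.2]%B && `[< gsc_valid S IJ.1 IJ.2 >])
    (#|IJ.1| + #|IJ.2|)%:R%:E.

End CubeIdeal.

Section VCDimension.
Variable n : nat.
Implicit Types (S : cube_system n) (I : {set 'I_n}).

Definition restr I (p : cube_point n) : {ffun {i : 'I_n | i \in I} -> bool} :=
  [ffun i => p (val i)].

Definition projection S I : {set {ffun {i : 'I_n | i \in I} -> bool}} :=
  [set restr I p | p in S]%SET.

Definition shattered S I : bool := projection S I == [set: _]%SET.

(* For S empty no index set is shattered and the maximum is 0. *)
Definition vc_dim S : nat := \max_(I : {set 'I_n} | shattered S I) #|I|.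

End VCDimension.

Section Entropy.
Variable R : realType.
Implicit Types e y : R.

Definition log2 (x : R) : R := ln x / ln 2.

Definition entropy e : R := - e * log2 e - (1 - e) * log2 (1 - e).

Lemma entropy0 : entropy 0 = 0.
Proof. by rewrite /entropy /log2 subr0 ln1 oppr0 !(mul0r, mulr0) subr0. Qed.

Definition entropy_inv : R -> R := 'pinv_(fun=> 0) `[0, 2^-1] entropy.

(* (+oo)^-1 = 0 in \bar R, so vc_rate +oo is entropy_inv 1. *)
Definition vc_rate (lam : \bar R) : R :=
  entropy_inv (1 - entropy (fine (lam^-1)%E)).

End Entropy.

Section ConnectivityInfinite.
Variables (R : realType) (n : nat).
Implicit Types (S : cube_system n) (I J : {set 'I_n}).

Lemma vec_of_point_conv S p : p \in S -> conv_hull S (vec_of_point R p).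
Proof.
move=> pS; exists (fun q => (q == p)%:R); split=> [q _||].
- exact: ler0n.
- by rewrite (bigD1 p) //= eqxx big1 ?addr0// => q /andP[_ /negPf->].
- rewrite (bigD1 p) //= eqxx scale1r big1 ?addr0// => q /andP[_ /negPf->].
  by rewrite scale0r.
Qed.

Lemma connectivity_eqy S : (connectivity R S = +oo)%E <-> S = [set: _]%SET.
Proof.
split=> [cy|->].
  apply/setP => p; rewrite !inE; apply: contraT => pS.
  pose I := [set i | ~~ p i]%SET; pose J := [set i | p i]%SET.
  suff IJv : [disjoint I & J]%B && `[< gsc_valid R S I J >].
    have : (connectivity R S <= (#|I| + #|J|)%:R%:E)%E.
      exact: (@bigmin_le_cond _ _ _ _ (I, J)).
    by rewrite cy.
  apply/andP; split.
    by rewrite -setI_eq0; apply/eqP/setP => i; rewrite !inE; case: (p i).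
  apply/asboolP => x [w [w0 w1 ->]] /=; rewrite /gsc_ineq.
  have -> : \sum_(j in J) (1 - (\sum_(p in S) w p *: vec_of_point R p) ord0 j)
      = \sum_(j in J) \sum_(q in S) w q * (1 - (q j)%:R).
    apply: eq_bigr => j _; rewrite summxE -{1}w1 -sumrB; apply: eq_bigr => q _.
    by rewrite !mxE mulrBr mulr1.
  have -> : \sum_(j in I) (\sum_(p in S) w p *: vec_of_point R p) ord0 j
      = \sum_(j in I) \sum_(q in S) w q * (q j)%:R.
    by apply: eq_bigr => j _; rewrite summxE; apply: eq_bigr => q _; rewrite !mxE.
  rewrite exchange_big/= [X in _ + X]exchange_big/= -big_split/= -{1}w1.
  apply: ler_sum => q qS; rewrite -!mulr_sumr -mulrDr ler_peMr ?w0//.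
  have : q != p by apply: contraNneq pS => <-.
  move=> /eqP/ffunP/existsNP[i /eqP qpi].
  case pi : (p i) qpi => qi.
    have iJ : i \in J by rewrite inE.
    rewrite (bigD1 i iJ)/=; case: (q i) qi => // _.
    rewrite subr0 addrCA lerDl addr_ge0// sumr_ge0// => k _.
    by rewrite subr_ge0; case: (q k).
  have iI : i \in I by rewrite inE pi.
  rewrite (bigD1 i iI)/=; case: (q i) qi => // _.
  rewrite -addrA lerDl addr_ge0// sumr_ge0// => k _.
  by rewrite subr_ge0; case: (q k).
rewrite /connectivity big_pred0// => -[I J] /=.
apply/negbTE/negP => /andP[dIJ /asboolP v].
have := v _ (vec_of_point_conv (finset.in_setT [ffun i => i \in J])).
rewrite /= /gsc_ineq big1 => [|i iI]; last first.
  by rewrite mxE ffunE (disjointFr dIJ).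
rewrite big1 ?addr0 ?ler10// => j jJ.
by rewrite mxE ffunE jJ subrr.
Qed.

End ConnectivityInfinite.

(* Main.v *)
(* Write e = 1 / lambda. A valid GSC inequality has at least lambda variables,
   so it holds on the subcube [e, 1 - e]^n, which therefore lies in conv(S).
   Writing a corner of this subcube as a mean of points of S shows that every
   q in {0,1}^n has a point of S at Hamming distance at most e * n: S is a
   covering code, and |S| >= 2^(n (1 - H(e))) since Hamming balls of radius
   e * n have at most 2^(n H(e)) points. On the other hand |S| is at most the
   number of sets it shatters. If all of these had size less than f * n with
   f = H^-1 (1 - H(e)) <= 1/2, there would be fewer than 2^(n H(f)) of them. *)

Require Import Defs.
From mathcomp Require Import all_boot all_order all_algebra.
From mathcomp Require Import all_classical all_reals all_analysis.
From mathcomp Require Import ring lra.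

Set Implicit Arguments.
Unset Strict Implicit.
Unset Printing Implicit Defensive.

Import Order.TTheory GRing.Theory Num.Theory.
Import numFieldNormedType.Exports.

Local Open Scope ring_scope.

(** * Shattered sets and Pajor's count *)

Section Shattering.
Variable n : nat.
Implicit Types (S : cube_system n) (A : {set 'I_n}) (p q : cube_point n).

(** Patterns on [A] are given by points [q] of the whole cube, which avoids functions on a
    subtype. *)
Lemma shatteredP S A :
  reflect (forall q, exists2 p, p \in S & {in A, p =1 q}) (shattered S A).
Proof.
apply: (iffP eqP) => [projT q|sh].
  have : restr A q \in projection S A by rewrite projT inE.
  move=> /imsetP[p pS /ffunP pq]; exists p => // i iA.
  by have := pq (Sub i iA); rewrite !ffunE.
apply/setP => g; rewrite inE.
have [p pS pq] := sh [ffun i => if insub i is Some j then g j else false].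
apply/imsetP; exists p => //; apply/ffunP => j.
by rewrite ffunE pq ?(valP j)// ffunE valK.
Qed.

Lemma shatteredS S1 S2 A : S1 \subset S2 -> shattered S1 A -> shattered S2 A.
Proof.
move=> /fintype.subsetP S12 /shatteredP sh; apply/shatteredP => q.
by have [p /S12 pS pq] := sh q; exists p.
Qed.

Lemma shattered_fiber_notin S (i : 'I_n) (b : bool) A :
  shattered [set p in S | p i == b] A -> i \notin A.
Proof.
move=> /shatteredP sh; apply/negP => iA.
have [p] := sh [ffun=> ~~ b].
by rewrite inE => /andP[_ /eqP pi] /(_ _ iA); rewrite ffunE pi; case: (b).
Qed.

(** A pattern [q] on [i |: A] is realised inside the half whose value at [i] is [q i]. *)
Lemma shatteredU1 S (i : 'I_n) A :
  (forall b, shattered [set p in S | p i == b] A) -> shattered S (i |: A).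
Proof.
move=> sh; apply/shatteredP => q; have /shatteredP/(_ q)[p] := sh (q i).
rewrite inE => /andP[pS /eqP pi] pq; exists p => // j.
by rewrite in_setU1 => /predU1P[->|/pq].
Qed.

(* Pajor's form of the Sauer-Shelah lemma. Split S by a coordinate i that is
   not constant on S: a set shattered by one half is shattered by S, and a set
   A shattered by both halves also yields the shattered set i |: A. *)
Lemma card_le_shattered S : (#|S| <= #|[set A | shattered S A]|)%N.
Proof.
have [k] := ubnP #|S|; elim: k S => // k IH S; rewrite ltnS => Sk.
case: (leqP #|S| 1) => [S1|S_gt1].
  have [->|[p pS]] := set_0Vmem S; first by rewrite cards0.
  apply: (leq_trans S1); apply/card_gt0P; exists finset.set0; rewrite inE.
  by apply/shatteredP => q; exists p => // i; rewrite inE.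
have [p [q [pS qS pq]]] := card_gt1P S_gt1.
have [i pqi] : exists i, p i != q i.
  by apply/existsP; apply: contraNT pq => /existsPn e; apply/eqP/ffunP => i;
    apply/eqP/negPn/e.
pose F b := [set r in S | r i == b].
pose sh b := [set A | shattered (F b) A].
have FS b : F b \subset S by apply/fintype.subsetP => r; rewrite inE => /andP[].
have cF : #|S| = (#|F true| + #|F false|)%N.
  rewrite -(cardsID [set r : cube_point n | r i] S); congr (_ + _)%N; apply: eq_card => r.
    by rewrite !inE eqb_id.
  by rewrite !inE andbC; case: (r i).
have Flt b : (#|F b| < k)%N.
  apply: leq_trans Sk; apply: proper_card; rewrite properE FS /=.
  apply/subsetPn; case pib : (p i == b).
    by exists q => //; rewrite inE qS /= -(eqP pib) eq_sym.
  by exists p => //; rewrite inE pS /= pib.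
rewrite cF (leq_trans (leq_add (IH _ (Flt true)) (IH _ (Flt false))))//.
rewrite -[X in (X <= _)%N]/(#|sh true| + #|sh false|)%N.
(* The intersection, the sets shattered by both halves, is counted by its image under adding [i]. *)
rewrite -cardsUI.
have inj : {in sh true :&: sh false &, injective (fun A => i |: A)}.
  move=> A B; rewrite !inE => /andP[/shattered_fiber_notin iA _].
  move=> /andP[/shattered_fiber_notin iB _] eAB.
  by rewrite -(setU1K iA) eAB setU1K.
rewrite -(card_in_imset inj) -cardsUI.
set D := (X in (_ + #|pred_of_set X| <= _)%N).
(* Sets shattered by one half avoid [i], while the new sets contain it. *)
have -> : D = finset.set0.
  apply/setP => B; rewrite !inE; apply/negP => /andP[shB /imsetP[A _ eB]].
  move: shB; rewrite eB => /orP[] /shattered_fiber_notin;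
    by rewrite setU11.
rewrite cards0 addn0; apply: subset_leq_card; apply/fintype.subsetP => B.
rewrite !inE => /orP[/orP[]|]; try exact: shatteredS.
move=> /imsetP[A]; rewrite !inE => /andP[At Af] ->.
by apply: shatteredU1 => -[].
Qed.

Lemma shattered_card_le S A : shattered S A -> (#|A| <= vc_dim S)%N.
Proof. by move=> sA; rewrite /vc_dim (bigD1 A)//= leq_maxl. Qed.

End Shattering.

(** * Binary entropy, its inverse, and counting small sets *)

Section EntropyTheory.
Variable R : realType.
Implicit Types e x y : R.

Let ln2_gt0 : 0 < ln (2 : R).
Proof. by rewrite ln_gt0// ltr1n. Qed.

Lemma entropy_ln e :
  entropy e * ln 2 = - (e * ln e) - (1 - e) * ln (1 - e).
Proof. by rewrite /entropy /log2; field; rewrite gt_eqF. Qed.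

Lemma oppr_ln_le x : 0 < x -> - ln x <= x^-1 - 1.
Proof.
move=> x0; rewrite -lnV// -{1}[x^-1](addrNK 1) addrC le_ln1Dx//.
by rewrite -subr_gt0 opprK addrNK invr_gt0.
Qed.

Lemma entropy_ge0 e : 0 <= e <= 1 -> 0 <= entropy e.
Proof.
move=> /andP[e0 e1]; rewrite -(pmulr_lge0 _ ln2_gt0) entropy_ln.
have l1 : ln e <= 0 by rewrite ln_le0.
have l2 : ln (1 - e) <= 0 by rewrite ln_le0// gerBl.
nra.
Qed.

Lemma entropy_le1 e : 0 <= e < 1 -> entropy e <= 1.
Proof.
move=> /andP[]; rewrite le_eqVlt => /predU1P[<- _|e0 e1].
  by rewrite entropy0.
rewrite -(ler_pM2r ln2_gt0) mul1r entropy_ln.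
(* The tangent line of [- x ln x] at [x = 1/2]; its values at [e] and [1 - e] add up to [ln 2]. *)
have bound x : 0 < x -> - (x * ln x) <= x * ln 2 + 2^-1 - x.
  move=> x0; have := @oppr_ln_le (2 * x) (mulr_gt0 (ltr0Sn _ _) x0).
  rewrite lnM ?posrE// => /(ler_wpM2l (ltW x0)).
  rewrite [x * (_ - 1)](_ : _ = 2^-1 - x); first by lra.
  by field; rewrite gt_eqF.
have := bound _ e0; have := bound (1 - e); rewrite subr_gt0 => /(_ e1); lra.
Qed.

Lemma entropy_half : entropy 2^-1 = 1 :> R.
Proof.
apply: (mulIf (lt0r_neq0 ln2_gt0)); rewrite entropy_ln.
have -> : 1 - 2^-1 = 2^-1 :> R by field.
by rewrite lnV ?posrE//; field.
Qed.

(* With a = b^2, the bound - ln b <= 1 / b gives - a ln a <= 2 b. *)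
Lemma entropy_small y : 0 < y -> exists2 a, 0 < a <= 2^-1 & entropy a <= y.
Proof.
move=> y0; pose b := Num.min 2^-1 (y * ln 2 / 3).
have b0 : 0 < b by rewrite lt_min invr_gt0 ltr0n/= divr_gt0 ?mulr_gt0.
have b2 : b <= 2^-1 by rewrite ge_min lexx.
(* The two entropy terms of [b * b], times [ln 2], are at most [2b(1 - b)] and [b^2], in total at
   most [3b]. *)
have by3 : b * 3 <= y * ln 2.
  by rewrite -ler_pdivlMr ?ltr0n// ge_min lexx orbT.
exists (b * b); first by apply/andP; split; nra.
rewrite -(ler_pM2r ln2_gt0) entropy_ln lnM ?posrE//.
have lb : - (b * ln b) <= 1 - b.
  have /(ler_wpM2l (ltW b0)) := oppr_ln_le b0.
  by rewrite mulrBr mulfV ?gt_eqF// mulr1; lra.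
have a1 : 0 < 1 - b * b by nra.
have la : - ((1 - b * b) * ln (1 - b * b)) <= b * b.
  have /(ler_wpM2l (ltW a1)) := oppr_ln_le a1.
  by rewrite mulrBr mulfV ?gt_eqF// mulr1; lra.
nra.
Qed.

Lemma continuous_entropy x : 0 < x < 1 -> {for x, continuous (@entropy R)}.
Proof.
move=> /andP[x0 x1].
have c1 : {for x, continuous (fun e : R => 1 - e)}.
  by apply: cvgB; [exact: cvg_cst|exact: cvg_id].
have cl : {for x, continuous (@log2 R)}.
  by apply: cvgM; [exact: continuous_ln|exact: cvg_cst].
have cl1 : {for x, continuous (fun e : R => log2 (1 - e))}.
  apply: (@continuous_comp _ _ _ (fun e : R => 1 - e) (@log2 R)) => //.
  apply: cvgM; last exact: cvg_cst.
  by apply: continuous_ln; rewrite subr_gt0.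
apply: cvgB; apply: cvgM => //.
by apply: cvgN; exact: cvg_id.
Qed.

(** For [y > 0] the intermediate value theorem is applied on [[a, 1/2]] with [a > 0] and
    [entropy a <= y], which keeps away from the singularity of [ln] at 0. *)
Lemma entropy_surj y : 0 <= y <= 1 -> exists2 x, 0 <= x <= 2^-1 & entropy x = y.
Proof.
move=> /andP[]; rewrite le_eqVlt => /predU1P[<- _|y0 y1].
  by exists 0; [rewrite lexx invr_ge0 ler0n|exact: entropy0].
have [a /andP[a0 a2] Ha] := entropy_small y0.
have [||c] := @IVT _ (@entropy R) a 2^-1 y a2.
- apply: continuous_in_subspaceT => x; rewrite inE /= in_itv /= => /andP[ax x2].
  by apply: continuous_entropy; apply/andP; split; lra.
- by rewrite entropy_half ge_min le_max Ha y1 orbT.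
rewrite in_itv /= => /andP[ac c2] <-; exists c => //.
by rewrite c2 andbT (le_trans (ltW a0)).
Qed.

Lemma entropy_invP y : 0 <= y <= 1 ->
  0 <= entropy_inv y <= 2^-1 /\ entropy (entropy_inv y) = y.
Proof.
move=> y01.
have sur : set_surj `[0, 2^-1]%classic `[0, 1]%classic (@entropy R).
  move=> z /=; rewrite in_itv /= => /entropy_surj[x x2 <-].
  by exists x => //=; rewrite in_itv.
have y01' : `[0, 1]%classic y by rewrite /= in_itv.
split.
  have /(_ (entropy_inv y)) := surjpinv_image_sub (dflt := fun=> 0) sur.
  rewrite /= in_itv /=; apply; exists y => //=; rewrite in_itv //=.
by apply: pinvK; rewrite inE; apply: sur.
Qed.

(* Under the product of n Bernoulli(f) measures, every set of size at most
   f * n has mass at least expR (- n * entropy f * ln 2). *)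
Lemma card_small_sets_lt n (f : R) (B : {set {set 'I_n}}) :
  (0 < n)%N -> 0 < f <= 2^-1 -> (forall A, A \in B -> #|A|%:R <= f * n%:R) ->
  #|B|%:R < expR (n%:R * (entropy f * ln 2)).
Proof.
move=> n0 /andP[f0 f2] Bs.
have f1 : 0 < 1 - f by lra.
pose mass (A : {set 'I_n}) := \prod_i (if i \in A then f else 1 - f).
have mass_gt0 A : 0 < mass A by apply: prodr_gt0 => i _; case: ifP.
have massE A : mass A = expR (#|A|%:R * ln f + (n%:R - #|A|%:R) * ln (1 - f)).
  rewrite /mass (bigID (mem A)) /=.
  rewrite (eq_bigr (fun=> f)) => [|i ->//]; rewrite prodr_const.
  rewrite (eq_bigr (fun=> 1 - f)) => [|i /negPf->//].
  have -> : \prod_(i | i \notin A) (1 - f) = (1 - f) ^+ (n - #|A|).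
    have -> : (n - #|A|)%N = #|~: A| by rewrite [RHS]cardsCs finset.setCK card_ord.
    by rewrite -prodr_const; apply: eq_bigl => i; rewrite inE.
  rewrite expRD -natrB ?expRM_natl ?lnK ?posrE//.
  by rewrite -[X in (_ <= X)%N]card_ord max_card.
have mass1 : \sum_A mass A = 1.
  rewrite -bigA_distr /= (eq_bigr (fun=> 1)) ?big1// => i _.
  by rewrite addrC subrK.
(* The full set has positive mass and lies outside [B]; this makes the bound strict. *)
have TB : [set: 'I_n] \notin B.
  apply/negP => /Bs; rewrite cardsT card_ord leNgt => /negP; apply.
  have : 0 < n%:R :> R by rewrite ltr0n.
  by move=> ?; nra.
have sumB : \sum_(A in B) mass A < 1.
  rewrite -mass1 [ltRHS](bigID (mem B)) /= ltrDl.
  rewrite (bigD1 finset.setT) //= ltr_pwDl // sumr_ge0 // => A _; exact: ltW.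
have mass_ge A : A \in B -> expR (- (n%:R * (entropy f * ln 2))) <= mass A.
  move=> /Bs Afn; rewrite massE ler_expR entropy_ln.
  (* Hence the mass does not increase with [#|A|], and the extreme case is [#|A| = f * n]. *)
  have : ln f <= ln (1 - f) by rewrite ler_ln ?posrE//; lra.
  move: Afn; set a := #|A|%:R; set u := ln f; set v := ln (1 - f) => h1 h2.
  nra.
have : #|B|%:R * expR (- (n%:R * (entropy f * ln 2))) < 1.
  apply: le_lt_trans sumB; rewrite mulr_natl -sumr_const.
  exact: ler_sum.
by rewrite expRN ltr_pdivrMr ?expR_gt0// mul1r.
Qed.

(** If [n = 0] or [f = 0], only the empty set can occur and the bound is 1. Radius 0 arises for
    infinite connectivity. *)
Lemma card_small_sets_le n (f : R) (B : {set {set 'I_n}}) :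
  0 <= f <= 2^-1 -> (forall A, A \in B -> #|A|%:R <= f * n%:R) ->
  #|B|%:R <= expR (n%:R * (entropy f * ln 2)).
Proof.
move=> /andP[f0 f2] Bs.
have only0 : (forall A, A \in B -> A = finset.set0) -> (#|B| <= 1)%N.
  move=> B0; rewrite -(cards1 (@finset.set0 'I_n)); apply: subset_leq_card.
  by apply/fintype.subsetP => A /B0 ->; rewrite inE.
case: (posnP n) => [n0|n0].
  rewrite [n in n%:R * _]n0 mul0r expR0 lern1; apply: only0 => A _.
  by apply/setP => i; have := ltn_ord i; rewrite {2}n0.
move: f0; rewrite le_eqVlt => /predU1P[f0|f0].
  rewrite -f0 entropy0 mul0r mulr0 expR0 lern1; apply: only0 => A /Bs.
  by rewrite -f0 mul0r lern0 cards_eq0 => /eqP.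
by apply/ltW/card_small_sets_lt => //; rewrite f0.
Qed.

End EntropyTheory.

(** * Cube-ideal systems as covering codes *)

Section Covering.
Variables (R : realType) (n : nat).
Implicit Types (S : cube_system n) (p q : cube_point n).

Definition diff_set p q : {set 'I_n} := [set i | p i != q i].

Lemma diff_set_inj p : injective (diff_set p).
Proof.
move=> q r /setP e; apply/ffunP => i; have := e i; rewrite !inE.
by case: (p i); case: (q i); case: (r i).
Qed.

Definition inner_corner (e : R) q : 'rV[R]_n :=
  \row_i (if q i then 1 - e else e).

(** Each coordinate [x_i] and each [1 - x_i] is at least [e], so a GSC inequality in [k] variables
    has left side at least [k * e]. *)
Lemma inner_corner_conv S (e : R) q :
  cube_ideal R S -> 0 <= e <= 2^-1 ->
  (forall I J : {set 'I_n}, [disjoint I & J] -> gsc_valid R S I J ->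
     1 <= (#|I| + #|J|)%:R * e) ->
  conv_hull S (inner_corner e q).
Proof.
move=> [L [U [G [Gd cS]]]] /andP[e0 e2] large; rewrite cS.
have bnd i : e <= inner_corner e q ord0 i <= 1 - e.
  by rewrite mxE; case: (q i); apply/andP; split; lra.
split=> [i _|i _|[I J] IJG].
- by case/andP: (bnd i) => + _; exact: le_trans.
- by case/andP: (bnd i) => _ /le_trans; apply; rewrite gerBl.
have vIJ : gsc_valid R S I J by rewrite /gsc_valid cS => x [_ _ /(_ _ IJG)].
apply: le_trans (large I J (Gd _ IJG) vIJ) _.
rewrite natrD mulrDl !mulr_natl -!sumr_const lerD// ler_sum// => i _.
  by case/andP: (bnd i).
by case/andP: (bnd i); lra.
Qed.

(* The point of conv(S) is a mean of points of S whose mean Hamming distance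
   to q is e * n. *)
Lemma close_point S (e : R) q : conv_hull S (inner_corner e q) ->
  exists2 p, p \in S & #|diff_set p q|%:R <= e * n%:R.
Proof.
move=> [w [w0 w1 xE]]; apply/exists2P/asboolP; apply: contraT => /asboolPn far.
have far' p : p \in S -> e * n%:R < #|diff_set p q|%:R.
  by move=> pS; rewrite ltNge; apply/negP => ?; apply: far; exists p.
have distE : \sum_(p in S) w p * #|diff_set p q|%:R = e * n%:R.
  transitivity (\sum_(p in S) \sum_i w p * (p i != q i)%:R).
    apply: eq_bigr => p _; rewrite -mulr_sumr -natr_sum; congr (_ * _%:R).
    by rewrite -sum1_card big_mkcond; apply: eq_bigr => i _; rewrite inE.
  rewrite exchange_big /= mulr_natr -[n in RHS]card_ord -sumr_const.
  apply: eq_bigr => i _.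
  have xi : inner_corner e q ord0 i = \sum_(p in S) w p * (p i)%:R.
    by rewrite xE summxE; apply: eq_bigr => p _; rewrite !mxE.
  case qi : (q i); move: xi; rewrite mxE qi => xi.
    transitivity (1 - (1 - e)); last by rewrite opprB addrC subrK.
    rewrite xi -[X in X - _]w1 -sumrB; apply: eq_bigr => p _.
    by case: (p i); rewrite ?mulr0 ?mulr1 ?subr0 ?subrr.
  by rewrite xi; apply: eq_bigr => p _; case: (p i).
(* If all gaps were positive, a zero weighted sum would force all weights to vanish, yet they sum to
   1. *)
have gap0 : \sum_(p in S) w p * (#|diff_set p q|%:R - e * n%:R) = 0.
  under eq_bigr do rewrite mulrBr.
  by rewrite sumrB -mulr_suml w1 mul1r distE subrr.
have w_eq0 p : p \in S -> w p = 0.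
  move=> pS.
  have h r : r \in S -> 0 <= w r * (#|diff_set r q|%:R - e * n%:R).
    by move=> rS; rewrite mulr_ge0 ?w0// subr_ge0 ltW// far'.
  have /eqP := psumr_eq0P h gap0 pS.
  by rewrite mulf_eq0 subr_eq0 (gt_eqF (far' _ pS)) orbF => /eqP.
by move: w1; rewrite big1// => /eqP; rewrite eq_sym oner_eq0.
Qed.

Lemma covering_card S (e : R) : 0 <= e <= 2^-1 ->
  (forall q, exists2 p, p \in S & #|diff_set p q|%:R <= e * n%:R) ->
  expR (n%:R * ((1 - entropy e) * ln 2)) <= #|S|%:R.
Proof.
move=> e2 cov.
pose ball p := [set q | #|diff_set p q|%:R <= e * n%:R].
have ball_le p : #|ball p|%:R <= expR (n%:R * (entropy e * ln 2)).
  (* Taking differences with [p] turns the ball into a family of small sets. *)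
  rewrite -(card_imset _ (@diff_set_inj p)); apply: card_small_sets_le => // A.
  by move=> /imsetP[q]; rewrite inE => ? ->.
have : (#|[set: cube_point n]| <= \sum_(p in S) #|ball p|)%N.
  have /leq_trans : (#|[set: cube_point n]| <= #|\bigcup_(p in S) ball p|)%N.
    apply: subset_leq_card; apply/fintype.subsetP => q _; have [p pS pq] := cov q.
    by apply/finset.bigcupP; exists p => //; rewrite inE.
  apply; elim/big_rec2: _ => [|p m B _ Bm]; first by rewrite cards0.
  by apply: leq_trans (leq_card_setU _ _) _; rewrite leq_add2l.
rewrite cardsT card_ffun card_bool card_ord -(ler_nat R) natr_sum natrX.
move=> /le_trans /(_ (ler_sum _ (fun p _ => ball_le p))).
have -> : 2 ^+ n = expR (n%:R * ln 2) :> R by rewrite expRM_natl lnK ?posrE.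
rewrite sumr_const -[leRHS]mulr_natl -ler_pdivrMr ?expR_gt0// -expRN -expRD.
by apply: le_trans; rewrite ler_expR; lra.
Qed.

End Covering.

(** * Comparing the covering bound with the number of shattered sets *)

Theorem theorem1p6 (R : realType) (n : nat) (S : cube_system n) (lam : \bar R)
    (S_cube_ideal : cube_ideal R S)
    (S_connectivity : connectivity R S = lam)
    (lam_ge3 : (3%:R%:E <= lam)%E) :
  vc_rate lam * n%:R <= (vc_dim S)%:R.
Proof.
rewrite /vc_rate; set e := fine _.
have [e2 large] : 0 <= e <= 2^-1 /\
    forall k : nat, (lam <= k%:R%:E)%E -> 1 <= k%:R * e.
  rewrite /e; case: (lam) lam_ge3 => [r| |]//=.
  - rewrite lee_fin => r3; have r0 : 0 < r by lra.
    rewrite inver gt_eqF//=; split=> [|k].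
      by rewrite invr_ge0 ltW//= lef_pV2 ?posrE//; lra.
    by rewrite lee_fin ler_pdivlMr// mul1r.
  (* Here [lam = +oo] and [e = 0]; no natural number [k] is at least [lam]. *)
  - by move=> _; rewrite lexx invr_ge0 ler0n.
have cov q : exists2 p, p \in S & #|diff_set p q|%:R <= e * n%:R.
  apply/close_point/inner_corner_conv => // I J dIJ vIJ; apply: large.
  rewrite -S_connectivity; apply: (@bigmin_le_cond _ _ _ _ (I, J)).
  by rewrite /= dIJ; apply/asboolP.
have Slow := covering_card e2 cov.
have e01 : 0 <= e < 1 by case/andP: e2 => ? ?; apply/andP; split; lra.
have y01 : 0 <= 1 - entropy e <= 1.
  rewrite subr_ge0 entropy_le1//= gerBl entropy_ge0//.
  by case/andP: e01 => -> /ltW.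
have [] := entropy_invP y01; set f := entropy_inv _ => /andP[f0 f2] Hf.
rewrite leNgt; apply/negP => dlt.
have n0 : (0 < n)%N.
  rewrite lt0n; apply/negP => /eqP n0; move: dlt.
  by rewrite [X in _ * X%:R]n0 mulr0 ltrn0.
have {}f0 : 0 < f.
  move: f0; rewrite le_eqVlt => /predU1P[f0|//].
  by move: dlt; rewrite -f0 mul0r ltrn0.
have : #|[set A | shattered S A]|%:R < expR (n%:R * (entropy f * ln 2)).
  apply: card_small_sets_lt => [//||A]; first by rewrite f0.
  rewrite inE => /shattered_card_le; rewrite -(ler_nat R) => /le_trans.
  by apply; exact: ltW.
(* Since [entropy f = 1 - entropy e], this upper bound is the lower bound on [#|S|] in [Slow]. *)
rewrite Hf => /lt_le_trans /(_ Slow); rewrite ltr_nat ltnNge.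
by rewrite card_le_shattered.
Qed.
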